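(* Let $(X,d)$ be a proper, uniquely geodesic, straight metric space and let $b\in X$. The visual compactification of $X$ based at $b$ is isomorphic to the horofunction compactification of $X$ if and only if the Busemann map $B:\overline{X}^v_b\to\overline{X}^h$ is continuous.
   Context: A geodesic in a metric space $(X,d)$ is a map $\gamma:I\to X$ from an interval $I\subset\mathbb{R}$ with $d(\gamma(t),\gamma(s))=|t-s|$. $X$ is proper if closed balls are compact; uniquely geodesic if any two distinct points are joined by a unique geodesic; straight if every geodesic segment is contained in a unique bi-infinite geodesic. A compactification of $X$ is a pair $(f,\overline{X})$ with $\overline X$ compact and $f:X\to\overline X$ an embedding with dense image. $(f_1,X_1)$ is finer than $(f_2,X_2)$ if there is a continuous map $\overline f_2:X_1\to X_2$ with $\overline f_2\circ f_1=f_2$. Two compactifications are isomorphic if each is finer than the other. Visual compactification based at $b$: let $D_b$ be the set of geodesic rays $\gamma:[0,\infty)\to X$ with $\gamma(0)=b$, with the topology of uniform convergence on compact sets. The map $(\theta,r)\mapsto\theta(r)$ is a homeomorphism $D_b\times[0,\infty)/(D_b\times\{0\})\to X$; $\overline{X}^v_b=X\cup D_b$ is given the topology of $D_b\times[0,\infty]/(D_b\times\{0\})$, with $D_b\times\{\infty\}$ identified with $D_b$. Horofunction compactification: $h:X\to C(X)$, $h(x)(\cdot)=d(x,\cdot)-d(x,b)$, where $C(X)$ has the topology of uniform convergence on compact sets; $h$ is an embedding, $\overline{X}^h=\overline{h(X)}$ is compact, and the horofunction compactification is $(h,\overline{X}^h)$. Busemann map: $B(x)=h(x)$ for $x\in X$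 and $B(\gamma)=B_\gamma:=\lim_{t\to\infty}h(\gamma(t))$ (which exists) for $\gamma\in D_b$. *)

(* Defs.v *)
From HB Require Import structures.
From mathcomp Require Import all_boot all_order all_algebra.
From mathcomp Require Import all_classical all_reals all_analysis.
From mathcomp Require Import ring lra.

Set Implicit Arguments.
Unset Strict Implicit.
Unset Printing Implicit Defensive.

Import Order.TTheory GRing.Theory Num.Theory.
Import numFieldNormedType.Exports.

Local Open Scope classical_set_scope.
Local Open Scope ring_scope.

Section geodesics.
Context {R : realType} (X : metricType R).

Definition geodesic (I : set R) (c : I -> X) :=
  forall s t : I, mdist (c t) (c s) = `|val t - val s|.

(* [I] and [J] are different types, so points of [R] in both intervals are
   matched through [val]. *)
Definition extends (I J : set R) (c : I -> X) (g : J -> X) :=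
  forall s : I, exists2 t : J, val t = val s & g t = c s.

Definition joins (x y : X) (c : `[0, mdist x y]%classic -> X) :=
  (forall s, val s = 0 -> c s = x) /\ (forall s, val s = mdist x y -> c s = y).

Definition proper_space :=
  forall (x : X) (r : R), compact [set y | mdist x y <= r].

Definition uniquely_geodesic :=
  forall x y : X, x <> y ->
    exists! c : `[0, mdist x y]%classic -> X, geodesic c /\ joins c.

(* Segments are nondegenerate ([u < v]): a single point does not determine a
   line. *)
Definition straight :=
  forall (u v : R) (c : `[u, v]%classic -> X), u < v -> geodesic c ->
    exists! g : [set: R] -> X, geodesic g /\ extends c g.

End geodesics.

Section compactifications.
Context {X : topologicalType}.

Definition embedding {Y : topologicalType} (f : X -> Y) :=
  [/\ injective f, continuous f &
      forall U, open U -> exists2 V, open V & f @` U = V `&` range f].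

Definition is_compactification {Y : topologicalType} (f : X -> Y) :=
  [/\ compact [set: Y], embedding f & dense (range f)].

Definition finer {Y1 Y2 : topologicalType} (f1 : X -> Y1) (f2 : X -> Y2) :=
  exists2 g : Y1 -> Y2, continuous g & g \o f1 = f2.

Definition isomorphic_compactifications {Y1 Y2 : topologicalType}
    (f1 : X -> Y1) (f2 : X -> Y2) :=
  [/\ is_compactification f1, is_compactification f2,
      finer f1 f2 & finer f2 f1].

End compactifications.

Section visual.
Context {R : realType} {X : metricType R} (b : X).

Definition halfline : set R := `[0, +oo[.
Definition ext_halfline : set (\bar R) := [set r | (0 <= r)%E].

Lemma in_halfline (r : R) : (r \in halfline) = (0 <= r).
Proof. by apply/idP/idP; rewrite inE /halfline/= in_itv/= andbT. Qed.

Lemma halfline0 : 0 \in halfline.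
Proof. by rewrite in_halfline. Qed.

Definition hl0 : halfline := exist _ 0 halfline0.

(* The nonnegative real [r] as a point of the half-line; [hl0] if [r < 0]. *)
Definition to_halfline (r : R) : halfline := insubd hl0 r.

(* D_b.  As a subset of [{family compact, halfline -> X}], it carries the
   topology of uniform convergence on compact sets. *)
Definition rays : set {family compact, halfline -> X} :=
  [set c | geodesic (c : halfline -> X) /\ c hl0 = b].

Definition ray_at (c : rays) (r : R) : X := (val c) (to_halfline r).

Definition visual : Type := (X + rays)%type.

Definition visual_emb (x : X) : visual := inl x.

(* On [ext_halfline], the last case only happens at [+oo]. *)
Definition polar (p : rays * ext_halfline) : visual :=
  match val p.2 with
  | r%:E => inl (ray_at p.1 r)
  | _ => inr p.1
  end.

HB.instance Definition _ := Choice.copy visual (X + rays)%type.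

(* The quotient topology of D_b * [0, +oo] / (D_b * {0}), transported to the
   disjoint union of X and D_b: [polar] induces the identification. *)
Definition visual_open (U : set visual) := open (polar @^-1` U).

Let visual_openT : visual_open setT.
Proof. by rewrite /visual_open preimage_setT; exact: openT. Qed.

Let visual_openI : setI_closed visual_open.
Proof. by move=> U V ? ?; rewrite /visual_open preimage_setI; exact: openI. Qed.

Let visual_open_bigU (I : Type) (f : I -> set visual) :
  (forall i, visual_open (f i)) -> visual_open (\bigcup_i f i).
Proof.
move=> fo; rewrite /visual_open preimage_bigcup.
by apply: bigcup_open => i _; exact: fo.
Qed.

HB.instance Definition _ :=
  isOpenTopological.Build visual visual_openT visual_openI visual_open_bigU.

End visual.

Section horofunctions.
Context {R : realType} {X : metricType R}.

(* C(X), with the topology of uniform convergence on compact sets. *)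
Definition cont_fun : Type := continuousType X R.

Definition cont_fun_val (f : cont_fun) : {family compact, X -> R} :=
  (f : continuousType X R).

HB.instance Definition _ := Choice.copy cont_fun (continuousType X R).
HB.instance Definition _ :=
  Topological.copy cont_fun (initial_topology cont_fun_val).

Definition cont_fun0 : cont_fun := mkcts (@cst_continuous X R 0).
HB.instance Definition _ := isPointed.Build cont_fun cont_fun0.

Definition nonexpansive (f : X -> R) :=
  forall y z, `|f y - f z| <= mdist y z.

Lemma nonexpansive_continuous (f : X -> R) : nonexpansive f -> continuous f.
Proof.
move=> lf y; apply/cvgrPdist_lt => e e0.
have : nbhs y (ball y e) by exact: nbhsx_ballx.
rewrite ballEmdist; apply: filterS => z /= yz.
exact: le_lt_trans (lf _ _) yz.
Qed.

Variable b : X.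

Definition horo_fun (x y : X) : R := mdist x y - mdist x b.

Lemma mdist_dist (x y z : X) : `|mdist x y - mdist x z| <= mdist y z.
Proof.
rewrite ler_norml; apply/andP; split.
  by have := metric_triangle x y z; lra.
by have := metric_triangle x z y; rewrite (metric_sym z y); lra.
Qed.

Lemma nonexpansive_horo_fun x : nonexpansive (horo_fun x).
Proof.
move=> y z; rewrite /horo_fun.
rewrite (_ : _ - _ = mdist x y - mdist x z); [exact: mdist_dist | ring].
Qed.

Lemma horo_fun_le x y : `|horo_fun x y| <= mdist y b.
Proof. exact: mdist_dist. Qed.

Definition horo (x : X) : cont_fun :=
  mkcts (nonexpansive_continuous (@nonexpansive_horo_fun x)).

Definition horo_compact : set cont_fun := closure (range horo).

Lemma horo_in (x : X) : horo x \in horo_compact.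
Proof. by rewrite inE; apply: subset_closure; exists x. Qed.

Definition horo_emb (x : X) : horo_compact := exist _ (horo x) (horo_in x).

Definition busemann_fun (c : rays b) : cont_fun :=
  lim (horo (ray_at c t) @[t --> +oo]).

Lemma to_halflineE (r : R) : val (to_halfline r) = Num.max 0 r.
Proof.
rewrite /to_halfline /insubd; case: insubP => [u hr ->|hr].
  have : r \in halfline by exact: hr.
  by rewrite in_halfline => r0; rewrite max_r.
have : ~~ (r \in halfline) by exact: hr.
by rewrite in_halfline -ltNge => r0; rewrite max_l// ltW.
Qed.

Lemma ray_at_dist (c : rays b) s t :
  mdist (ray_at c t) (ray_at c s) = `|Num.max 0 t - Num.max 0 s|.
Proof.
have [gc _] := set_valP c.
by rewrite /ray_at gc !to_halflineE.
Qed.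

Lemma ray_at0 (c : rays b) t : mdist (ray_at c t) b = Num.max 0 t.
Proof.
have [gc c0] := set_valP c.
rewrite -[X in mdist _ X]c0 /ray_at gc to_halflineE/= subr0 ger0_norm//.
by rewrite le_max lexx.
Qed.

Lemma horo_ray_nincr (c : rays b) y s t : s <= t ->
  horo_fun (ray_at c t) y <= horo_fun (ray_at c s) y.
Proof.
move=> st; rewrite /horo_fun !ray_at0.
have := metric_triangle (ray_at c t) (ray_at c s) y.
have mst : Num.max 0 s <= Num.max 0 t by rewrite ge_max !le_max lexx st orbT.
rewrite ray_at_dist ger0_norm ?subr_ge0//; lra.
Qed.

Lemma horo_ray_cvg (c : rays b) y :
  cvg (horo_fun (ray_at c t) y @[t --> +oo]).
Proof.
set f := fun t => horo_fun (ray_at c t) y.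
have hi : has_inf (range f).
  split; first by exists (f 0), 0.
  exists (- mdist y b) => _ [t _ <-].
  by have := horo_fun_le (ray_at c t) y; rewrite ler_norml => /andP[].
apply/cvg_ex; exists (inf (range f)); apply/cvgrPdist_lt => e e0.
have [_ [t0 _ <-] ft0] := inf_adherent e0 hi.
near=> t.
have t0t : t0 <= t by near: t; apply: nbhs_pinfty_ge; exact: num_real.
have ft : f t <= f t0 by exact: horo_ray_nincr.
have : inf (range f) <= f t by apply: ge_inf; [case: hi | exists t].
rewrite -/(f t) => lft; rewrite distrC ger0_norm ?subr_ge0//; lra.
Unshelve. all: by end_near. Qed.

Let busemann_lim (c : rays b) y : R :=
  lim (horo_fun (ray_at c t) y @[t --> +oo]).

Let nonexpansive_busemann_lim c : nonexpansive (busemann_lim c).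
Proof.
move=> y z; apply/ler_addgt0Pl => e e0.
have e20 : 0 < e / 2 by rewrite divr_gt0.
near (@pinfty_nbhs R) => t.
have hy : `|busemann_lim c y - horo_fun (ray_at c t) y| < e / 2.
  by near: t; have /cvgrPdist_lt := @horo_ray_cvg c y; exact.
have hz : `|busemann_lim c z - horo_fun (ray_at c t) z| < e / 2.
  by near: t; have /cvgrPdist_lt := @horo_ray_cvg c z; exact.
have := @nonexpansive_horo_fun (ray_at c t) y z.
move: hy hz; rewrite !ler_norml !ltr_norml.
move=> /andP[? ?] /andP[? ?] /andP[? ?]; apply/andP; split; lra.
Unshelve. all: by end_near. Qed.

Let equicontinuous_nonexpansive : equicontinuous [set f | nonexpansive f] id.
Proof.
move=> x E; rewrite -entourage_ballE => -[e /= e0 eE].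
have : nbhs x (ball x e) by exact: nbhsx_ballx.
rewrite ballEmdist; apply: filterS => y /= xy f lf; apply: eE => /=.
exact: le_lt_trans (lf _ _) xy.
Qed.

Lemma cvg_cont_fun (F : set_system cont_fun) (f : cont_fun) : Filter F ->
  {family compact, cont_fun_val @ F --> cont_fun_val f} -> F --> f.
Proof.
move=> FF Ff A [_ [[C oC <-] Cf] CA].
have : F (cont_fun_val @^-1` C).
  by apply: Ff; apply: open_nbhs_nbhs; split.
exact: filterS.
Qed.

Lemma busemann_fun_cvg (c : rays b) :
  horo (ray_at c t) @[t --> +oo] --> busemann_fun c.
Proof.
suff : cvg (horo (ray_at c t) @[t --> +oo]) by [].
pose l : cont_fun :=
  mkcts (nonexpansive_continuous (@nonexpansive_busemann_lim c)).
apply/cvg_ex; exists l.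
apply: cvg_cont_fun.
apply/pointwise_compact_cvg => /=.
  apply/near_powerset_filter_fromP; first exact: equicontinuous_subset_id.
  exists [set f | nonexpansive f]; last exact: equicontinuous_nonexpansive.
  suff : \forall t \near +oo, nonexpansive (horo_fun (ray_at c t)) by [].
  by near=> t; exact: nonexpansive_horo_fun.
by apply/pointwise_cvgP => y; exact: horo_ray_cvg.
Unshelve. all: by end_near. Qed.

Lemma busemann_fun_in (c : rays b) : busemann_fun c \in horo_compact.
Proof.
rewrite inE => A cA.
have At : \forall t \near +oo, A (horo (ray_at c t)).
  exact: busemann_fun_cvg cA.
have [t {}At] := filter_ex At.
by exists (horo (ray_at c t)); split => //; exists (ray_at c t).
Qed.

Definition busemann_map (p : visual b) : horo_compact :=
  match p with
  | inl x => horo_emb x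
  | inr c => exist _ (busemann_fun c) (busemann_fun_in c)
  end.

End horofunctions.
Arguments cont_fun {R} X.

(* Main.v *)
Require Import Defs.
From HB Require Import structures.
From mathcomp Require Import all_boot all_order all_algebra.
From mathcomp Require Import all_classical all_reals all_analysis.
From mathcomp Require Import lra.
Import numFieldNormedType.Exports.
Local Open Scope classical_set_scope.
Local Open Scope ring_scope.

(** Both spaces are compactifications of [X], and [horo_compact b] is
    Hausdorff, so the statement is about the maps between them.

    If the compactifications are isomorphic, there is a continuous
    [g : visual b -> horo_compact b] that is [horo_emb b] on [X].  Along a ray
    [c], the points [ray_at c t] tend to the ideal point [c] in [visual b]
    ([visual_ray_cvg]), while [horo b (ray_at c t)] tends to the Busemann
    function of [c].  Limits are unique, so [g] is the Busemann map
    ([continuous_extension_busemann]).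

    Conversely, a continuous Busemann map makes the visual compactification
    the finer one.  Its image is compact and contains the dense set
    [range (horo_emb b)], so it is surjective.  Straightness makes it
    injective, whether or not it is continuous ([busemann_map_injective]):
    - a function [horo b x] is bounded below, a Busemann function is not;
    - if [c1] and [c2] have the same Busemann function [B], extend them to
      lines [g1] and [g2].  Then [B (g1 s) = - s] and [B (g2 t) = - t], so for
      [s <= 0 <= t] the points [g1 s] and [g2 t] are at distance at least
      [t - s], because [B] is nonexpansive; they are at distance at most
      [t - s], through [b].  Hence [g1] on the negative side followed by [c2]
      is a line.  It shares a segment with [g1], so it is [g1], and [c1 = c2].
    A continuous bijection from a compact space to a Hausdorff one has a
    continuous inverse, which shows that the horofunction compactification is
    also finer than the visual one.

    That the two spaces are compactifications rests on the Arzela-Ascoli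
    theorem: the rays from [b] form a compact space ([rays_compact]), and so do
    the nonexpansive functions vanishing at [b] ([normalized_compact]). *)

Set Implicit Arguments.
Unset Strict Implicit.
Unset Printing Implicit Defensive.
Import Order.TTheory GRing.Theory Num.Theory.

(** * Initial topologies, compactness and separation *)

Section topology.

Lemma compact_initial (S : choiceType) (T : topologicalType) (f : S -> T)
    (A : set (initial_topology f)) : compact (f @` A) -> compact A.
Proof.
move=> cA F FF FA.
have [_ [[a Aa <-] clfa]] : (f @` A) `&` cluster (f @ F) !=set0.
  apply: cA; apply: (@filterS _ F _ A) FA => s As.
  by exists s.
exists a; split => // B C FB [_ [[U oU <-] Ufa] UC].
have [_ [[s Bs <-] Us]] : (f @` B) `&` U !=set0.
  apply: clfa; last by exact: open_nbhs_nbhs.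
  by apply: (@filterS _ F _ B) FB => s Bs; exists s.
by exists s; split => //; exact: UC.
Qed.

Lemma cvg_initial (S : choiceType) (T : topologicalType) (f : S -> T)
    (F : set_system (initial_topology f)) (s : initial_topology f) :
  Filter F -> f @ F --> f s -> F --> s.
Proof.
move=> FF Ff A [_ [[U oU <-] Us] UA]; apply: filterS UA _.
by apply: Ff; exact: open_nbhs_nbhs.
Qed.

Lemma hausdorff_separating (T : topologicalType) (I : Type)
    (Y : I -> topologicalType) (f : forall i, T -> Y i) :
  (forall i, hausdorff_space (Y i)) -> (forall i, continuous (f i)) ->
  (forall p q, (forall i, f i p = f i q) -> p = q) -> hausdorff_space T.
Proof.
move=> hY cf sep p q pq; apply: sep => i; apply: hY => A B fpA fqB.
have [z [Az Bz]] : f i @^-1` A `&` f i @^-1` B !=set0 by apply: pq; exact: cf.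
by exists (f i z).
Qed.

(** The preimage of a closed set under [g] is its image under [f], which is
    compact, hence closed. *)
Lemma compact_hausdorff_inverse (S T : topologicalType)
    (f : S -> T) (g : T -> S) :
  compact [set: S] -> hausdorff_space T -> continuous f ->
  cancel f g -> cancel g f -> continuous g.
Proof.
move=> cS hT cf fK gK; apply/continuous_closedP => A cA.
suff -> : g @^-1` A = f @` A.
  apply: compact_closed => //; apply: continuous_compact.
    exact: continuous_subspaceT.
  exact: subclosed_compact cS _.
apply/seteqP; split => [t At|_ [s As <-]] /=; last by rewrite fK.
by exists (g t).
Qed.

(** A form of Arzela-Ascoli in which closedness is checked pointwise: on an
    equicontinuous set, closures for compact convergence and for pointwise
    convergence agree. *)
Lemma compact_equicontinuous_ptws (S : topologicalType) (Y : puniformType)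
    (W : set (S -> Y)) (K : S -> set Y) : hausdorff_space Y ->
  equicontinuous W id -> (forall s, compact (K s)) ->
  (forall s f, W f -> K s (f s)) -> closed (W : set {ptws S -> Y}) ->
  compact (W : set {family compact, S -> Y}).
Proof.
move=> hY eW cK WK clW.
suff : precompact (W : set {family compact, S -> Y}).
  rewrite precompactE (pointwise_compact_closure eW).
  by move/closure_id : clW => <-.
apply: pointwise_precompact_equicontinuous => // s.
apply: (@precompact_subset _ _ (K s)).
  by move=> _ [f Wf <-]; exact: WK.
exact: compact_precompact.
Qed.

Lemma eval_family_continuous (S : topologicalType) (Y : uniformType) (s : S) :
  continuous (fun f : {family compact, S -> Y} => f s).
Proof.
move=> f.
have /pointwise_cvg_compact_family :
  {family compact, nbhs (f : {family compact, S -> Y}) --> f} by [].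
by move/pointwise_cvgP; exact.
Qed.

Lemma family_compact_hausdorff (S : topologicalType) (Y : uniformType) :
  hausdorff_space Y -> hausdorff_space {family compact, S -> Y}.
Proof.
move=> hY; apply: (@hausdorff_separating _ S (fun=> Y)
  (fun s (f : {family compact, S -> Y}) => f s)) => //.
- exact: eval_family_continuous.
- by move=> f g fg; exact/funext.
Qed.

Lemma compact_set_type (T : topologicalType) (A : set T) :
  compact A -> compact [set: A].
Proof.
move=> cA; apply: (@compact_initial A T set_val).
suff -> : set_val @` [set: A] = A by [].
apply/seteqP; split => [_ [a _ <-]|a Aa]; first exact: set_valP.
by exists (exist _ a (mem_set Aa)).
Qed.

(** A filter that does not cluster at [+oo] contains a bounded set, hence a
    compact segment. *)
Lemma ext_halfline_compact (R : realType) : compact [set: @ext_halfline R].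
Proof.
apply: compact_set_type => F FF F0.
have [clF|nclF] := pselect (cluster F +oo%E).
  by exists +oo%E; split => //; rewrite /ext_halfline /= leey.
have [B FB [M MB]] :
    exists2 B, F B & exists M : R, forall x, B x -> (x <= M%:E)%E.
  apply: contrapT => nB; apply: nclF => B C FB [M [_ MC]].
  apply: contrapT => BC; apply: nB; exists B => //; exists M => x Bx.
  rewrite leNgt; apply/negP => Mx; apply: BC; exists x; split => //.
  exact: MC.
have cI : compact (EFin @` `[0, M]%classic).
  apply: continuous_compact; last exact: segment_compact.
  by apply: continuous_subspaceT => x C.
have [|y [[r /= + <-] cly]] := cI F FF.
  apply: filterS (filterI F0 FB) => -[r||] [/= x0 /MB]//=.
  by rewrite lee_fin => rM; exists r => //=; rewrite in_itv/= -lee_fin x0.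
rewrite in_itv /= => /andP[r0 rM].
by exists r%:E; split; rewrite // /ext_halfline/= lee_fin.
Qed.

End topology.

(** * Rays from the base point *)

Section rays_lemmas.
Context {R : realType} (X : metricType R) (b : X).

(** [X] pointed at [b], with the same uniform structure: Arzela-Ascoli is stated
    for maps into a pointed space. *)
Let ptX : puniformType :=
  HB.pack_for puniformType (Metric.sort X) (isPointed.Build (Metric.sort X) b).

Lemma mdist_near (x : X) (e : R) : 0 < e ->
  \forall y \near x, mdist x y < e.
Proof.
move=> e0; have : nbhs x (ball x e) by exact: nbhsx_ballx.
by rewrite ballEmdist.
Qed.

Lemma mdist_diff (x y x' y' : X) :
  `|mdist x y - mdist x' y'| <= mdist x x' + mdist y y'.
Proof.
have := metric_triangle x x' y; have := metric_triangle x' y' y.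
have := metric_triangle x' x y'; have := metric_triangle x y y'.
rewrite (metric_sym x' x) (metric_sym y' y) ler_norml => *.
apply/andP; split; lra.
Qed.

Lemma mdist_cvg T (F : set_system T) (f g : T -> X) x y : Filter F ->
  f @ F --> x -> g @ F --> y -> mdist (f t) (g t) @[t --> F] --> mdist x y.
Proof.
move=> FF fx gy; apply/cvgrPdist_lt => e e0.
have e20 : 0 < e / 2 by rewrite divr_gt0.
have hf : F [set t | mdist x (f t) < e / 2] by exact: fx (mdist_near x e20).
have hg : F [set t | mdist y (g t) < e / 2] by exact: gy (mdist_near y e20).
apply: filterS (filterI hf hg) => t [/= ? ?].
by apply: le_lt_trans (mdist_diff _ _ _ _) _; lra.
Qed.

Lemma geodesic_near (s : @halfline R) (e : R) : 0 < e ->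
  \forall t \near s, forall c : @halfline R -> X,
    geodesic c -> mdist (c s) (c t) < e.
Proof.
move=> e0.
have : continuous (val : @halfline R -> R) by exact: initial_continuous.
move=> /(_ s) /cvgrPdist_lt /(_ _ e0); apply: filterS => t st d gd.
by rewrite gd.
Qed.

Lemma rays_closed : closed (rays b : set {ptws @halfline R -> X}).
Proof.
have -> : (rays b : set {ptws @halfline R -> X}) =
  (\bigcap_(st in [set: @halfline R * @halfline R])
    [set c | mdist (c st.1 : X) (c st.2) = `|val st.1 - val st.2|]) `&`
    [set c | c (@hl0 R) = b].
  apply/seteqP; split => [c [gc cb]|c [gc cb]].
    by split => // -[s t] _ /=; exact: gc.
  by split => // s t; exact: (gc (t, s) I).
have ev (s : @halfline R) : continuous (fun c : {ptws @halfline R -> X} => c s).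
  by move=> c; exact: (@proj_continuous _ (fun=> X) s c).
apply: closedI.
  apply: closed_bigI => -[s t] _ /=.
  apply: (@closed_comp _ _ (fun c : {ptws @halfline R -> X} =>
    mdist (c s : X) (c t : X)) [set `|val s - val t|]).
    move=> c _.
    exact: (@mdist_cvg _ (nbhs c) _ _ _ _ _ (ev s c) (ev t c)).
  exact: closed_eq.
apply: (@closed_comp _ _
  (fun c : {ptws @halfline R -> X} => c (@hl0 R)) [set b]).
  by move=> c _; exact: ev.
apply: compact_closed; [exact: metric_hausdorff|exact: compact_set1].
Qed.

(** The rays are isometric embeddings, hence equicontinuous, and a ray is at
    time [s] in the ball of radius [s], which is compact. *)
Lemma rays_compact : proper_space X -> compact [set: rays b].
Proof.
move=> X_proper; apply: compact_set_type.
have hX : hausdorff_space ptX by exact: (@metric_hausdorff R X).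
apply: (@compact_equicontinuous_ptws (@halfline R) ptX (@rays R X b)
   (fun s => [set y | mdist b y <= val s])) => //.
- move=> s E; rewrite -entourage_ballE => -[e /= e0 eE].
  apply: filterS (geodesic_near s e0) => t + c [gc _] => /(_ c gc) ct.
  by apply: eE; rewrite /= ballEmdist.
- move=> s c [gc cb]; rewrite /= -cb gc.
  by have := valP s; rewrite in_halfline => s0; rewrite sub0r normrN ger0_norm.
- exact: rays_closed.
Qed.

End rays_lemmas.

(** * The visual compactification *)

Section visual_lemmas.
Context {R : realType} (X : metricType R) (b : X).

(** Truncated at [0], so as to be defined on [R]; [ray_at] truncates in the same
    way ([polar_ext_of]). *)
Definition ext_of (r : R) : @ext_halfline R.
Proof.
exists (Num.max 0 r)%:E; apply: mem_set.
by rewrite /ext_halfline /= lee_fin le_max lexx.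
Defined.

Definition ext_infty : @ext_halfline R.
Proof. by exists +oo%E; apply: mem_set; rewrite /ext_halfline /= leey. Defined.

Lemma ext_of_cvg : ext_of t @[t --> +oo] --> ext_infty.
Proof.
apply: (@cvg_initial _ _ set_val (ext_of t @[t --> +oo]) ext_infty).
move=> A [M [_ MA]].
apply: (filterS _ (nbhs_pinfty_gt (num_real M))) => t Mt; apply: MA => /=.
by rewrite lte_fin lt_max Mt orbT.
Qed.

Lemma ray_at_max (c : rays b) (r : R) : ray_at c (Num.max 0 r) = ray_at c r.
Proof.
apply: mdist_positivity; rewrite ray_at_dist.
by rewrite [X in X - _]max_r ?subrr ?normr0 // le_max lexx.
Qed.

Lemma polar_ext_of (c : rays b) (r : R) :
  polar (c, ext_of r) = inl (ray_at c r).
Proof. by rewrite /polar /= ray_at_max. Qed.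

Lemma polar_continuous : continuous (@polar R X b).
Proof. by apply/continuousP => U oU; exact: oU. Qed.

Lemma visual_ray_cvg (c : rays b) :
  (inl (ray_at c t) : visual b) @[t --> +oo] --> (inr c : visual b).
Proof.
have cE : (c, ext_of t) @[t --> +oo] --> (c, ext_infty).
  apply: (@cvg_pair _ _ _ _ (nbhs c) (nbhs ext_infty)); last exact: ext_of_cvg.
  exact: cvg_cst.
have := cvg_comp _ _ cE (@polar_continuous (c, ext_infty)).
by under [X in X @ _]eq_fun do rewrite /= polar_ext_of.
Qed.

Lemma max0_nonexpansive (x y : R) :
  `|Num.max 0 x - Num.max 0 y| <= `|x - y|.
Proof.
have := ler_norm (x - y); have := ler_norm (y - x); rewrite (distrC y x).
by case: (leP 0 x) => ?; case: (leP 0 y) => ?; rewrite ler_norml => ? ?;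
  apply/andP; split; lra.
Qed.

(** Polar coordinates are jointly continuous at finite radius: rays are
    nonexpansive in the radius, uniformly in the ray. *)
Lemma ray_at_continuous (c : rays b) (r : @ext_halfline R) (s : R) :
  val r = s%:E ->
  ray_at p.1 (fine (val p.2)) @[p --> (c, r)] --> ray_at c s.
Proof.
move=> rs A /nbhs_ballP [e /= e0]; rewrite ballEmdist => eA.
have e20 : 0 < e / 2 by rewrite divr_gt0.
have Hc : \forall c' \near c, mdist (ray_at c s) (ray_at c' s) < e / 2.
  have vc : continuous (val : rays b -> {family compact, @halfline R -> X}).
    exact: initial_continuous.
  have := cvg_comp _ _ (vc c)
    (@eval_family_continuous _ _ (to_halfline s) (val c)).
  by move=> /(_ _ (mdist_near _ e20)).
have Hr : \forall r' \near r, `|s - fine (val r')| < e / 2.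
  have vr : continuous (val : @ext_halfline R -> \bar R).
    exact: initial_continuous.
  have : fine (val r') @[r' --> r] --> s.
    apply: (cvg_comp _ _ (vr r)); rewrite rs.
    by move=> B.
  by move=> /cvgrPdist_lt; apply.
exists ([set c' | mdist (ray_at c s) (ray_at c' s) < e / 2],
        [set r' | `|s - fine (val r')| < e / 2]) => //= -[c' r'] /= [cc rr].
apply: eA => /=.
apply: le_lt_trans (metric_triangle _ (ray_at c' s) _) _.
have := max0_nonexpansive s (fine (val r')).
by rewrite ray_at_dist; lra.
Qed.

Lemma visual_emb_open (U : set X) : open U -> open (@visual_emb R X b @` U).
Proof.
move=> oU.
suff : open (@polar R X b @^-1` (@visual_emb R X b @` U)) by [].
rewrite openE => -[c r] [x Ux]; rewrite /polar /=.
case E : (val r) => [s||]//= [xE].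
have Us : nbhs (ray_at c s) U by rewrite -xE; exact: open_nbhs_nbhs.
have Ucr : \forall p \near (c, r), U (ray_at p.1 (fine (val p.2))).
  exact: (ray_at_continuous E Us).
have fr : \forall p \near (c, r), val p.2 \is a fin_num.
  have : \forall r' \near r, val r' \is a fin_num.
    have vr : (val : @ext_halfline R -> \bar R) @ r --> s%:E.
      by rewrite -E; exact: initial_continuous.
    apply: (vr [set x | x \is a fin_num]).
    suff : \forall t \near s, t%:E \is a fin_num by [].
    by exists 1 => /=.
  move=> N; exists (setT, [set r' : @ext_halfline R | val r' \is a fin_num]).
    by split => //=; exact: filterT.
  by move=> [c' r'] [].
apply: (@filterS _ (nbhs (c, r)) _ _ _ _ (filterI Ucr fr)).
move=> -[c' r'] /= [Uc].
case E' : (val r') Uc => [t||]//= Uc _.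
by exists (ray_at c' t).
Qed.

Lemma visual_emb_dense : dense (range (@visual_emb R X b)).
Proof.
move=> U [[x|c] Up] oU; first by exists (inl x); split => //; exists x.
have Uc : nbhs (inr c : visual b) U by exact: open_nbhs_nbhs.
have /filter_ex [t Ut] : \forall t \near +oo, U (inl (ray_at c t)).
  exact: (visual_ray_cvg Uc).
by exists (inl (ray_at c t)); split => //; exists (ray_at c t).
Qed.

(** The geodesic from [b] to [x] extends to a line, and the half of that line
    starting at [b] is the ray. *)
Lemma ray_through (x : X) : uniquely_geodesic X -> straight X -> x <> b ->
  exists c : rays b, ray_at c (mdist x b) = x.
Proof.
move=> ug st xb.
have [k [[gk [k0 kd]] _]] := ug b x (nesym xb).
have bx : 0 < mdist b x by rewrite mdist_gt0; apply/eqP; exact: nesym.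
have [g [[gg ext] _]] := st _ _ _ bx gk.
pose c : {family compact, @halfline R -> X} :=
  fun s => g (exist _ (val s) (mem_set I)).
have in0 : (0 : R) \in `[0, mdist b x]%classic.
  by rewrite inE /= in_itv/= lexx ltW.
have ind : (mdist b x : R) \in `[0, mdist b x]%classic.
  by rewrite inE /= in_itv/= lexx ltW.
pose s0 : `[0, mdist b x]%classic := exist (fun r => r \in _) 0 in0.
pose sd : `[0, mdist b x]%classic := exist (fun r => r \in _) (mdist b x) ind.
have gE (t t' : [set: R]) : val t = val t' -> g t = g t'.
  by move=> /val_inj ->.
have cb : c (@hl0 R) = b.
  rewrite -(k0 s0 erefl).
  have [t tE <-] := ext s0; exact: gE.
have cR : rays b c.
  by split => // s t; rewrite /c gg.
exists (exist _ c (mem_set cR)).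
rewrite -[RHS](kd sd erefl).
have [t tE <-] := ext sd; apply: gE.
by rewrite /= to_halflineE tE /= max_r ?mdist_ge0// metric_sym.
Qed.

(** The point [inl b] is left out because it is not a value of [polar] when [X]
    is a single point: there are no rays then. *)
Lemma polar_surj (p : visual b) : uniquely_geodesic X -> straight X ->
  p <> inl b -> exists q, polar q = p.
Proof.
move=> ug st; case: p => [x|c] pb; last by exists (c, ext_infty).
have xb : x <> b by move=> xb; apply: pb; rewrite xb.
have [c cx] := ray_through ug st xb.
by exists (c, ext_of (mdist x b)); rewrite polar_ext_of cx.
Qed.

Lemma visual_compact : proper_space X -> uniquely_geodesic X -> straight X ->
  compact [set: visual b].
Proof.
move=> X_proper ug st.
have -> : [set: visual b] = @polar R X b @` setT `|` [set inl b].
  apply/seteqP; split => // p _.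
  have [->|pb] := pselect (p = inl b); first by right.
  by left; have [q qp] := polar_surj ug st pb; exists q.
apply: compactU; last exact: compact_set1.
apply: continuous_compact; first exact: continuous_subspaceT polar_continuous.
rewrite -setXTT; apply: compact_setX; first exact: rays_compact.
exact: ext_halfline_compact.
Qed.

Lemma closed_bounded (A : set X) :
  (forall r, closed (A `&` [set x | mdist b x <= r])) -> closed A.
Proof.
move=> cA x clx; have : closure (A `&` [set y | mdist b y <= mdist b x + 1]) x.
  move=> B xB; have x1 := mdist_near x (@ltr01 R).
  have [y [Ay [By xy]]] := clx _ (filterI xB x1).
  exists y; split => //; split => //=.
  by have := metric_triangle b x y; move: xy => /=; lra.
by move/(cA _) => [].
Qed.

(** Let [A] be closed in the visual compactification.  The polar coordinates of
    the points of [A] of radius at most [r] form a compact set [K], and their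
    image in [X] is compact, hence closed; up to the point [b], it is the trace
    of [A] on the closed ball of radius [r]. *)
Lemma visual_emb_continuous :
  proper_space X -> uniquely_geodesic X -> straight X ->
  continuous (@visual_emb R X b).
Proof.
move=> X_proper ug st; apply/continuous_closedP => A cA.
apply: closed_bounded => r.
pose e (p : rays b * @ext_halfline R) := ray_at p.1 (fine (val p.2)).
pose K := @polar R X b @^-1` A `&` [set p | (val p.2 <= r%:E)%E].
have Kfin p : K p -> val p.2 = (fine (val p.2))%:E.
  case: p => c [x x0] [_ /= xr]; rewrite fineK//.
  have : (0 <= x)%E by move: x0; rewrite inE.
  by case: x xr {x0} => // y; rewrite leye_eq.
have cK : compact K.
  apply: (@subclosed_compact _ _ setT) => //.
    apply: closedI.
      by apply: closed_comp cA => p _; exact: polar_continuous.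
    apply: (@closed_comp _ _ (fun p : rays b * @ext_halfline R => val p.2)
      [set x | (x <= r%:E)%E]).
      move=> p _; apply: continuous_comp; first exact: cvg_snd.
      exact: initial_continuous.
    exact: closed_ereal_ge_ereal.
  rewrite -setXTT; apply: compact_setX; first exact: rays_compact.
  exact: ext_halfline_compact.
have eK : compact (e @` K).
  apply: continuous_compact => //; apply: continuous_in_subspaceT => -[c x].
  rewrite inE => /Kfin /=; exact: ray_at_continuous.
have clb : closed [set y | y = b /\ A (inl b) /\ 0 <= r].
  have [h|h] := pselect (A (inl b) /\ 0 <= r).
    rewrite (_ : mkset _ = [set b]).
      apply: compact_closed; [exact: metric_hausdorff|exact: compact_set1].
    by apply/seteqP; split => [y []|y ->].
  rewrite (_ : mkset _ = set0); first exact: closed0.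
  by apply/seteqP; split => // y [_ /h].
suff -> : @visual_emb R X b @^-1` A `&` [set x | mdist b x <= r] =
    e @` K `|` [set y | y = b /\ A (inl b) /\ 0 <= r].
  apply: closedU => //; apply: compact_closed eK; exact: metric_hausdorff.
apply/seteqP; split => [x [/= Ax xr]|x [[p Kp <-]|[-> [Ab r0]]]].
- have [xb|xb] := pselect (x = b).
    by subst x; right; split => //; split => //; move: xr; rewrite mdistxx.
  left; have [c cx] := ray_through ug st xb.
  exists (c, ext_of (mdist x b)).
    split; first by rewrite /= polar_ext_of cx.
    by rewrite /= lee_fin max_r ?mdist_ge0// metric_sym.
  by rewrite /e /= max_r ?mdist_ge0.
- case: (Kp) (Kfin _ Kp); rewrite /e /polar /= => + + pf.
  rewrite pf lee_fin => Ap pr; split => //=.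
  rewrite metric_sym ray_at0 max_r//.
  by have := set_valP p.2; rewrite /ext_halfline /= pf lee_fin.
- by split => //=; rewrite mdistxx.
Qed.

End visual_lemmas.

(** * The horofunction compactification *)

Section horo_lemmas.
Context {R : realType} (X : metricType R) (b : X).

Lemma cont_fun_val_continuous : continuous (@cont_fun_val R X).
Proof. exact: initial_continuous. Qed.

Lemma eval_continuous_cont_fun (y : X) :
  continuous (fun f : cont_fun X => cont_fun_val f y).
Proof.
move=> f.
exact: (cvg_comp _ _ (@cont_fun_val_continuous f)
  (@eval_family_continuous X R y (cont_fun_val f))).
Qed.

Lemma cont_fun_ext (f g : cont_fun X) :
  (forall y, cont_fun_val f y = cont_fun_val g y) -> f = g.
Proof. by move=> fg; apply/continuousEP => y; exact: fg. Qed.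

Lemma cont_fun_hausdorff : hausdorff_space (cont_fun X).
Proof.
apply: (@hausdorff_separating _ X (fun=> R) (fun y f => cont_fun_val f y)).
- by move=> _; exact: Rhausdorff.
- exact: eval_continuous_cont_fun.
- exact: cont_fun_ext.
Qed.

Lemma horo_compact_hausdorff : hausdorff_space (horo_compact b).
Proof.
apply: (@hausdorff_separating _ unit (fun=> cont_fun X)
  (fun _ (f : horo_compact b) => val f : cont_fun X)).
- by move=> _; exact: cont_fun_hausdorff.
- by move=> _; exact: initial_continuous.
- by move=> p q /(_ tt); exact: val_inj.
Qed.

(** A compact set containing all horofunctions ([horo_compact_normalized]). *)
Definition normalized : set (X -> R) := [set f | nonexpansive f /\ f b = 0].

Lemma horo_normalized x : normalized (horo_fun b x).
Proof. by split; [exact: nonexpansive_horo_fun|exact: subrr]. Qed.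

Lemma normalized_bound f y : normalized f -> `|f y| <= mdist y b.
Proof. by move=> [nf fb]; have := nf y b; rewrite fb subr0. Qed.

Lemma normalized_equicontinuous : equicontinuous normalized id.
Proof.
move=> x E; rewrite -entourage_ballE => -[e /= e0 eE].
apply: filterS (mdist_near x e0) => y /= xy f [nf _].
by apply: eE => /=; exact: le_lt_trans (nf _ _) xy.
Qed.

Lemma normalized_closed : closed (normalized : set {ptws X -> R}).
Proof.
have -> : (normalized : set {ptws X -> R}) =
    (\bigcap_(yz in [set: X * X])
      [set f | `|f yz.1 - f yz.2| <= mdist yz.1 yz.2]) `&` [set f | f b = 0].
  apply/seteqP; split => [f [nf fb]|f [nf fb]].
    by split => // -[y z] _ /=; exact: nf.
  by split => // y z; exact: (nf (y, z) I).
have ev (y : X) : continuous (fun f : {ptws X -> R} => f y).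
  by move=> f; exact: (@proj_continuous _ (fun=> R) y f).
apply: closedI.
  apply: closed_bigI => -[y z] _ /=.
  apply: (@closed_comp _ _ (fun f : {ptws X -> R} => `|f y - f z|)
    [set r | r <= mdist y z]).
    move=> f _; exact: (cvg_norm (cvgB (ev y f) (ev z f))).
  exact: closed_le.
apply: (@closed_comp _ _ (fun f : {ptws X -> R} => f b) [set 0]).
  by move=> f _; exact: ev.
exact: closed_eq.
Qed.

Lemma normalized_compact : compact (normalized : set {family compact, X -> R}).
Proof.
apply: (@compact_equicontinuous_ptws X R normalized
   (fun y => `[- mdist y b, mdist y b]%classic)) => //.
- exact: normalized_equicontinuous.
- by move=> y; exact: segment_compact.
- move=> y f /normalized_bound => /(_ y).
  by rewrite /= in_itv/= ler_norml.
- exact: normalized_closed.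
Qed.

Lemma horo_compact_normalized :
  horo_compact b `<=` @cont_fun_val R X @^-1` normalized.
Proof.
pose W := @cont_fun_val R X @^-1` normalized.
have clW : closed W.
  apply: (@closed_comp _ _ (@cont_fun_val R X)).
    by move=> f _; exact: cont_fun_val_continuous.
  apply: compact_closed normalized_compact.
  by apply: family_compact_hausdorff; exact: Rhausdorff.
rewrite /horo_compact -/W [X in _ `<=` X](closure_id W).1//.
by apply: closureS => _ [x _ <-]; exact: horo_normalized.
Qed.

Lemma horo_compact_compact : compact [set: horo_compact b].
Proof.
apply: compact_set_type.
pose W := @cont_fun_val R X @^-1` normalized.
have cW : compact W.
  apply: (@compact_initial _ _ (@cont_fun_val R X)).
  suff -> : @cont_fun_val R X @` W = normalized by exact: normalized_compact.
  apply/seteqP; split => [_ [f Wf <-] //|f nf].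
  have [ne _] := nf.
  by exists (mkcts (nonexpansive_continuous ne)).
apply: (subclosed_compact _ cW); first exact: closed_closure.
exact: horo_compact_normalized.
Qed.

Lemma horo_continuous : continuous (@horo R X b).
Proof.
move=> x; apply: cvg_cont_fun.
apply/pointwise_compact_cvg => /=.
  apply/near_powerset_filter_fromP; first exact: equicontinuous_subset_id.
  exists normalized.
    apply: (@filterS _ (nbhs x) _ setT) filterT => y _.
    exact: horo_normalized.
  exact: normalized_equicontinuous.
apply/pointwise_cvgP => y.
by apply: cvgB; apply: mdist_cvg; (exact: cvg_id || exact: cvg_cst).
Qed.

Lemma horo_injective : injective (@horo R X b).
Proof.
move=> x y xy; apply: mdist_positivity.
have E z : horo_fun b x z = horo_fun b y z.
  exact: (congr1 (fun f => cont_fun_val f z) xy).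
have := E x; have := E y; rewrite /horo_fun !mdistxx (metric_sym y x); lra.
Qed.

Lemma horo_emb_injective : injective (@horo_emb R X b).
Proof. by move=> x y /(congr1 val); exact: horo_injective. Qed.

Lemma horo_emb_continuous : continuous (@horo_emb R X b).
Proof.
by apply: (@continuous_comp_initial _ _ _ set_val); exact: horo_continuous.
Qed.

Lemma horo_emb_dense : dense (range (@horo_emb R X b)).
Proof.
move=> U [f Uf] [V oV VU]; move: Uf; rewrite -VU => Vf.
have [_ [[x _ <-] Vx]] := set_valP f _ (open_nbhs_nbhs (conj oV Vf)).
by exists (horo_emb b x); split => //; exists x.
Qed.

Lemma geodesic_point (x y : X) (e : R) : uniquely_geodesic X ->
  0 <= e <= mdist x y -> exists2 z, mdist x z = e & mdist z y = mdist x y - e.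
Proof.
move=> ug /andP[e0 exy].
have [xy|xy] := pselect (x = y).
  subst y; move: exy; rewrite mdistxx => e1.
  have -> : e = 0 by lra.
  by exists x; rewrite mdistxx ?subrr.
have [k [[gk [k0 kd]] _]] := ug x y xy.
have dxy := mdist_ge0 x y.
have mk r : 0 <= r <= mdist x y -> r \in `[0, mdist x y]%classic.
  by move=> r0; rewrite inE /= in_itv/=.
have h0 := mk 0 _; have he := mk e _; have hd := mk (mdist x y) _.
pose s r h : `[0, mdist x y]%classic := exist (fun r => r \in _) r h.
rewrite lexx dxy in h0; rewrite e0 exy in he; rewrite lexx dxy in hd.
exists (k (s _ (he isT))).
  rewrite -[X in mdist X _](k0 (s _ (h0 isT)) erefl) gk /= sub0r normrN.
  by rewrite ger0_norm.
rewrite -[X in mdist _ X](kd (s _ (hd isT)) erefl) gk /= distrC ger0_norm//.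
by rewrite subr_ge0.
Qed.

(** If [y] is at distance at least [e] from [x], let [z] be the point of the
    geodesic from [x] to [y] at distance [e] from [x].  From [x] to [z],
    [horo b x] increases by [e] and [horo b y] decreases by [e], so these
    functions cannot be [e / 2]-close on the closed ball of radius [e] around
    [x]. *)
Lemma horo_separates (x : X) (e : R) : proper_space X -> uniquely_geodesic X ->
  0 < e -> \forall f \near horo b x, forall y, f = horo b y -> mdist x y < e.
Proof.
move=> X_proper ug e0.
have e20 : 0 < e / 2 by rewrite divr_gt0.
have cB : compact [set z | mdist x z <= e] by exact: X_proper.
have Bn := @fam_nbhs X R compact _ _ (cont_fun_val (horo b x))
  (entourage_ball _ (PosNum e20)) cB.
have {}Bn : \forall f \near horo b x, forall z, mdist x z <= e ->
    `|horo_fun b x z - cont_fun_val f z| < e / 2.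
  exact: (@cont_fun_val_continuous (horo b x) _ Bn).
apply: filterS Bn => f /= fx y fy; rewrite ltNge; apply/negP => exy.
have [z xz zy] : exists2 z, mdist x z = e & mdist z y = mdist x y - e.
  by apply: geodesic_point => //; rewrite exy ltW.
have fE w : cont_fun_val f w = horo_fun b y w by rewrite fy.
have := fx x; have := fx z; rewrite !fE /horo_fun mdistxx xz.
rewrite (metric_sym y z) zy (metric_sym y x) => /(_ (lexx _)) + /(_ (ltW e0)).
by rewrite !ltr_norml; lra.
Qed.

Lemma horo_emb_open (U : set X) : proper_space X -> uniquely_geodesic X ->
  open U ->
  exists2 V, open V & @horo_emb R X b @` U = V `&` range (@horo_emb R X b).
Proof.
move=> X_proper ug oU.
pose V := [set f | forall y, f = horo_emb b y -> U y].
exists (interior V); first exact: open_interior.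
apply/seteqP; split => [_ [x Ux <-]|f [Vf [y _ fy]]].
  split; last by exists x.
  have /nbhs_ballP [e /= e0] : nbhs x U by exact: open_nbhs_nbhs.
  rewrite ballEmdist => eU.
  have vc : continuous (val : horo_compact b -> cont_fun X).
    exact: initial_continuous.
  have fe : \forall f \near horo_emb b x,
      forall y, val f = horo b y -> mdist x y < e.
    exact: (vc (horo_emb b x) _ (horo_separates x X_proper ug e0)).
  by apply: filterS fe => f /= fe y fy; apply/eU/fe; rewrite fy.
by exists y => //; exact: (interior_subset Vf).
Qed.

End horo_lemmas.

(** * Straight lines and Busemann functions *)

Section busemann.
Context {R : realType} (X : metricType R) (b : X).

(** Geodesic lines, as functions on [R] itself rather than on the type of points
    of [setT]. *)
Definition isometric (g : R -> X) := forall s t, mdist (g s) (g t) = `|s - t|.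

Lemma straight_unique (u v : R) (g1 g2 : R -> X) : straight X -> u < v ->
  isometric g1 -> isometric g2 -> (forall t, u <= t <= v -> g1 t = g2 t) ->
  g1 =1 g2.
Proof.
move=> st uv i1 i2 e12.
pose line (g : R -> X) : [set: R] -> X := fun t => g (val t).
pose k : `[u, v]%classic -> X := fun t => g1 (val t).
have gk : geodesic k by move=> s t; rewrite /k i1.
have [h [_ hu]] := st u v k uv gk.
have h1 : h = line g1.
  apply: hu; split; first by move=> s t; rewrite /line i1.
  by move=> s; exists (exist _ (val s) (mem_set I)).
have h2 : h = line g2.
  apply: hu; split; first by move=> s t; rewrite /line i2.
  move=> s; exists (exist _ (val s) (mem_set I)) => //.
  rewrite /line /k /= e12//.
  by have := set_valP s; rewrite /= in_itv.
move=> t; have := congr1 (fun f => f (exist _ t (mem_set I))) h1.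
by rewrite h2.
Qed.

Lemma straight_extend (u v : R) (f : R -> X) : straight X -> u < v ->
  (forall s t, u <= s <= v -> u <= t <= v -> mdist (f s) (f t) = `|s - t|) ->
  exists2 g, isometric g & forall t, u <= t <= v -> g t = f t.
Proof.
move=> st uv fi.
pose k : `[u, v]%classic -> X := fun t => f (val t).
have kin (t : `[u, v]%classic) : u <= val t <= v.
  by have := set_valP t; rewrite /= in_itv.
have gk : geodesic k by move=> s t; rewrite /k fi.
have [h [[gh eh] _]] := st u v k uv gk.
exists (fun t => h (exist _ t (mem_set I))); first by move=> s t; rewrite gh.
move=> t tuv.
have tin : t \in `[u, v]%classic by rewrite inE /= in_itv.
have [t' tE ht'] := eh (exist (fun r => r \in _) t tin).
rewrite -[RHS]ht'; congr h; exact/esym/val_inj.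
Qed.

(** The lines extending longer and longer initial segments of [c] all coincide,
    because they agree on the first one. *)
Lemma ray_line (c : rays b) : straight X ->
  exists2 g, isometric g & forall t, 0 <= t -> g t = ray_at c t.
Proof.
move=> st.
have ext N : 0 < N ->
    exists2 g, isometric g & forall t, 0 <= t <= N -> g t = ray_at c t.
  move=> N0; apply: straight_extend => // s t /andP[s0 _] /andP[t0 _].
  by rewrite ray_at_dist !max_r.
have [g gi gc] := ext 1 ltr01.
exists g => // t t0.
have [h hi hc] := ext (t + 1) ltac:(lra).
rewrite -hc; last by rewrite t0; lra.
apply: (straight_unique st ltr01) => // s /andP[s0 s1].
by rewrite gc ?hc// s0//=; lra.
Qed.

Lemma busemann_eval_cvg (c : rays b) y :
  horo_fun b (ray_at c t) y @[t --> +oo] --> cont_fun_val (busemann_fun c) y.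
Proof.
exact: (cvg_comp _ _ (@busemann_fun_cvg R X b c)
  (@eval_continuous_cont_fun R X y (busemann_fun c))).
Qed.

(** For [t] large, [horo b (ray_at c t)] at [g s] is already
    [(t - s) - t = - s]. *)
Lemma busemann_line (c : rays b) (g : R -> X) s : isometric g ->
  (forall t, 0 <= t -> g t = ray_at c t) ->
  cont_fun_val (busemann_fun c) (g s) = - s.
Proof.
move=> gi gc; apply: (cvg_unique (@Rhausdorff R) (@busemann_eval_cvg c (g s))).
apply: cvg_near_cst.
near=> t.
have t0 : 0 <= t by near: t; apply: nbhs_pinfty_ge; exact: num_real.
have st : s <= t by near: t; apply: nbhs_pinfty_ge; exact: num_real.
rewrite /horo_fun -gc// gi gc// ray_at0 max_r// ger0_norm ?subr_ge0//; lra.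
Unshelve. all: by end_near. Qed.

Lemma rays_ext (c1 c2 : rays b) :
  (forall t, 0 <= t -> ray_at c1 t = ray_at c2 t) -> c1 = c2.
Proof.
move=> c12; apply/val_inj/funext => s.
have s0 : 0 <= val s by have := valP s; rewrite in_halfline.
have -> : s = to_halfline (val s) by apply: val_inj; rewrite to_halflineE max_r.
exact: c12.
Qed.

Lemma busemann_fun_injective : straight X -> injective (@busemann_fun R X b).
Proof.
move=> st c1 c2 c12.
have [g1 i1 g1c] := ray_line c1 st; have [g2 i2 g2c] := ray_line c2 st.
have g10 : g1 0 = b.
  by apply: mdist_positivity; rewrite g1c// ray_at0 max_r.
have g20 : g2 0 = b.
  by apply: mdist_positivity; rewrite g2c// ray_at0 max_r.
have cross s t : s <= 0 -> 0 <= t -> mdist (g1 s) (g2 t) = t - s.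
  move=> s0 t0; apply/eqP; rewrite eq_le; apply/andP; split.
    have := metric_triangle (g1 s) b (g2 t).
    have -> : mdist (g1 s) b = - s.
      by rewrite -[X in mdist _ X]g10 i1 subr0 ler0_norm.
    have -> : mdist b (g2 t) = t.
      by rewrite -[X in mdist X _]g20 i2 sub0r normrN ger0_norm.
    lra.
  (* The common Busemann function is nonexpansive: this bounds the distance
     from below. *)
  have [ne _] := horo_compact_normalized (set_mem (busemann_fun_in c1)).
  have := ne (g1 s) (g2 t).
  rewrite (busemann_line _ i1 g1c) c12 (busemann_line _ i2 g2c).
  by rewrite ler_norml; lra.
(* The reversed ray of [c1], followed by [c2]. *)
pose k t := if t <= 0 then g1 t else g2 t.
have ki : isometric k.
  move=> s t; rewrite /k; case: (leP s 0) => s0; case: (leP t 0) => t0 //.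
    by rewrite cross ?(ltW t0)// distrC ger0_norm//; lra.
  by rewrite metric_sym cross ?(ltW s0)// ger0_norm//; lra.
have kg1 : k =1 g1.
  apply: (straight_unique st (ltrN10 R)) => // t /andP[_ t0].
  by rewrite /k t0.
apply: rays_ext => t t0; rewrite -g1c// -g2c// -kg1 /k.
case: (leP t 0) => // t1.
by have -> : t = 0; [lra|rewrite g10 g20].
Qed.

(** A value of [horo b x] is at least [- mdist x b], while a Busemann function
    takes the value [- (mdist x b + 1)] on its ray. *)
Lemma busemann_map_injective : straight X -> injective (@busemann_map R X b).
Proof.
move=> st.
have XD x (c : rays b) : horo b x <> busemann_fun c.
  move=> xc; have [g gi gc] := ray_line c st.
  have : horo_fun b x (g (mdist x b + 1)) = - (mdist x b + 1).
    by rewrite -(busemann_line _ gi gc) -xc.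
  by have := mdist_ge0 x (g (mdist x b + 1)); rewrite /horo_fun; lra.
move=> [x|c] [y|d] /(congr1 val) /= E.
- by rewrite (horo_injective E).
- by case: (XD _ _ E).
- by case: (XD _ _ (esym E)).
- by rewrite (busemann_fun_injective st E).
Qed.

Lemma visual_is_compactification :
  proper_space X -> uniquely_geodesic X -> straight X ->
  is_compactification (@visual_emb R X b).
Proof.
move=> X_proper ug st; split.
- exact: visual_compact.
- split.
  + by move=> x y [].
  + exact: visual_emb_continuous.
  + (* [X] is open in the visual compactification, so [V] is the image. *)
    move=> U oU; exists (visual_emb b @` U); first exact: visual_emb_open.
    by apply/esym/setIidPl => _ [x _ <-]; exists x.
- exact: visual_emb_dense.
Qed.

Lemma horo_is_compactification :
  proper_space X -> uniquely_geodesic X ->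
  is_compactification (@horo_emb R X b).
Proof.
move=> X_proper ug; split.
- exact: horo_compact_compact.
- split; first exact: horo_emb_injective.
  + exact: horo_emb_continuous.
  + by move=> U; exact: horo_emb_open.
- exact: horo_emb_dense.
Qed.

Lemma continuous_extension_busemann (g : visual b -> horo_compact b) :
  continuous g -> g \o visual_emb b = horo_emb b -> g = busemann_map (b := b).
Proof.
move=> cg gE; apply/funext => -[x|c]; first by rewrite -[LHS]/((g \o _) x) gE.
apply: val_inj => /=.
have vc : continuous (val : horo_compact b -> cont_fun X).
  exact: initial_continuous.
have h : horo b (ray_at c t) @[t --> +oo] --> (val (g (inr c)) : cont_fun X).
  have := cvg_comp _ _
    (cvg_comp _ _ (@visual_ray_cvg R X b c) (cg (inr c))) (vc _).
  have -> // : val \o (g \o (fun t => inl (ray_at c t))) =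
      fun t => horo b (ray_at c t).
  by apply/funext => t /=; rewrite -[g (inl _)]/((g \o visual_emb b) _) gE.
exact: (cvg_unique (@cont_fun_hausdorff R X) h (@busemann_fun_cvg R X b c)).
Qed.

Lemma busemann_map_surjective :
  proper_space X -> uniquely_geodesic X -> straight X ->
  continuous (@busemann_map R X b) ->
  forall f, exists p, busemann_map (b := b) p = f.
Proof.
move=> X_proper ug st cB f.
have clB : closed (range (@busemann_map R X b)).
  apply: compact_closed; first exact: horo_compact_hausdorff.
  apply: continuous_compact; first exact: continuous_subspaceT.
  exact: visual_compact.
have : closure (range (@horo_emb R X b)) f.
  move=> B; rewrite nbhsE => -[U [oU Uf] UB].
  have [y [Uy ry]] := @horo_emb_dense R X b U (ex_intro _ f Uf) oU.
  by exists y; split => //; exact: UB.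
have /closureS : range (@horo_emb R X b) `<=` range (@busemann_map R X b).
  by move=> _ [x _ <-]; exists (inl x).
move=> /[apply]; rewrite -(closure_id _).1// => -[p _ <-]; by exists p.
Qed.

End busemann.

Theorem proposition1p3 (R : realType) (X : metricType R) (b : X)
    (X_proper : proper_space X) (X_uniquely_geodesic : uniquely_geodesic X)
    (X_straight : straight X) :
  isomorphic_compactifications (@visual_emb R X b) (@horo_emb R X b) <->
  continuous (@busemann_map R X b).
Proof.
split => [[_ _ [g cg gE] _]|cB].
  by rewrite -(continuous_extension_busemann cg gE).
split.
- exact: visual_is_compactification.
- exact: horo_is_compactification.
- by exists (busemann_map (b := b)).
have [g gB] := choice
  (busemann_map_surjective X_proper X_uniquely_geodesic X_straight cB).
have Bg : cancel (busemann_map (b := b)) g.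
  by move=> p; apply: (busemann_map_injective X_straight); rewrite gB.
exists g; last by apply/funext => x; exact: (Bg (inl x)).
apply: compact_hausdorff_inverse cB Bg gB; last exact: horo_compact_hausdorff.
exact: visual_compact.
Qed.
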